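(* Let $L$ be a complete lattice whose top element $1$ is completely join-irreducible, and let $f$ be an $\mathfrak{f}$-mapping on $L$. Then the binary operator $T: L^2\to L$ defined by $$T(x,y)=\begin{cases} x\wedge y & \text{if } 1\in\{x,y\},\\ f(x)\wedge_{\mathrm{Im}(f)} f(y) & \text{otherwise}\end{cases}$$ is a left-continuous t-norm on $L$.
   Context: $L$ is a complete lattice with bottom element $0$ and top element $1$; $\wedge$ is the meet of $L$. An element $z\in L$ is completely join-irreducible if, for every subset $X\subseteq L$, $z=\bigvee X$ implies $z\in X$. A complete lattice $M$ is join-infinite distributive if $a\wedge(\bigvee S)=\bigvee_{s\in S}(a\wedge s)$ for all $a\in M$ and all nonempty $S\subseteq M$. A mapping $f:L\to L$ is an $\mathfrak{f}$-mapping if: (i) $f(1)=1$; (ii) $f(x)\le x$ for all $x\in L$; (iii) $f(f(x))=f(x)$ for all $x\in L$; (iv) $f(\bigvee S)=\bigvee_{s\in S}f(s)$ for every nonempty $S\subseteq L$; (v) the image $\mathrm{Im}(f)=\{f(x)\mid x\in L\}$ is a join-infinite distributive lattice under the partial order inherited from $L$. The symbol $\wedge_{\mathrm{Im}(f)}$ denotes the meet operation of the lattice $\mathrm{Im}(f)$ (with the order inherited from $L$); it need not coincide with the meet of $L$. A t-norm on $L$ is a binary operator $T:L^2\to L$ such that for all $a,b,c\in L$: $T(1,a)=a$; $b\le c$ implies $T(a,b)\le T(a,c)$; $T(a,b)=T(b,a)$; $T(T(a,b),c)=T(a,T(b,c))$. It is left-continuous if $T(a,\bigvee S)=\bigvee_{s\in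 S}T(a,s)$ for all $a\in L$ and all nonempty $S\subseteq L$. *)

(* Defs.v *)
From HB Require Import structures.
From mathcomp Require Import all_boot all_order.
From mathcomp Require Import boolp classical_sets.

Set Implicit Arguments.
Unset Strict Implicit.
Unset Printing Implicit Defensive.

Import Order.TTheory.

Local Open Scope classical_set_scope.
Local Open Scope order_scope.

Definition complete_lattice d (M : porderType d) : Prop :=
  forall X : set M, supremums X !=set0 /\ infimums X !=set0.

(* Meet computed from the order alone, for posets that carry no declared
   lattice structure. The default value x of [infimum] is returned only if
   {x, y} has no infimum. *)
Definition pmeet d (M : porderType d) (x y : M) : M := infimum x [set x; y].

(* The default value a of [supremum] is never used: S is nonempty and M is
   complete. *)
Definition join_infinite_distributive d (M : porderType d) : Prop :=
  complete_lattice M /\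
  forall (a : M) (S : set M), S !=set0 ->
    pmeet a (supremum a S) = supremum a [set pmeet a s | s in S].

(* The default value \bot is the value of [supremum] on the empty set, which is
   the correct empty join. *)
Definition bigjoin d (L : tbLatticeType d) (X : set L) : L := supremum \bot X.

Definition completely_join_irreducible d (L : tbLatticeType d) (z : L) : Prop :=
  forall X : set L, z = bigjoin X -> X z.

(* The image of f as a type of its own, ordered by the order of L. *)
Record Im d (L : tbLatticeType d) (f : L -> L) : Type := Im_sub {
  Im_val : L;
  Im_valP : Im_val \in range f
}.

HB.instance Definition _ d (L : tbLatticeType d) (f : L -> L) :=
  [isSub for @Im_val d L f].
HB.instance Definition _ d (L : tbLatticeType d) (f : L -> L) :=
  [Choice of Im f by <:].
HB.instance Definition _ d (L : tbLatticeType d) (f : L -> L) :=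
  [SubChoice_isSubPOrder of Im f by <: with d].

Definition to_Im d (L : tbLatticeType d) (f : L -> L) (x : L) : Im f :=
  Im_sub (mem_set (imageT f x)).

Record f_mapping d (L : tbLatticeType d) (f : L -> L) : Prop := {
  f_mapping_top : f \top = \top;
  f_mapping_le : forall x, f x <= x;
  f_mapping_idem : forall x, f (f x) = f x;
  f_mapping_join : forall S : set L, S !=set0 ->
    f (bigjoin S) = bigjoin [set f s | s in S];
  f_mapping_Im : join_infinite_distributive (Im f)
}.

Record t_norm d (L : tbLatticeType d) (T : L -> L -> L) : Prop := {
  t_norm_top : forall a, T \top a = a;
  t_norm_mono : forall a b c, b <= c -> T a b <= T a c;
  t_norm_comm : forall a b, T a b = T b a;
  t_norm_assoc : forall a b c, T (T a b) c = T a (T b c)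
}.

Definition left_continuous d (L : tbLatticeType d) (T : L -> L -> L) : Prop :=
  forall (a : L) (S : set L), S !=set0 ->
    T a (bigjoin S) = bigjoin [set T a s | s in S].

Definition T_of d (L : tbLatticeType d) (f : L -> L) (x y : L) : L :=
  if (x == \top) || (y == \top) then x `&` y
  else \val (pmeet (to_Im f x) (to_Im f y)).

(* Main.v *)
(** Away from [\top], [T_of f] is the meet of [Im f] applied to the images under
    [f], and [f] fixes its values, which lie below both arguments; associativity
    is then that of the meet. Joins of [Im f] coincide with joins of [L] because
    [f] preserves joins, so distributivity of [Im f] gives left-continuity
    whenever [\top] is not in the set; irreducibility of [\top] ensures that the
    join of such a set is not [\top]. If [\top] is in the set, the join of the
    values is attained there. *)

Require Import Defs.
From mathcomp Require Import all_boot all_order.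
From mathcomp Require Import boolp classical_sets.
Import Order.TTheory.
Local Open Scope classical_set_scope.
Local Open Scope order_scope.

Section CompletePoset.
Set Implicit Arguments.
Unset Strict Implicit.
Context {d : Order.disp_t} {M : porderType d} (Mc : complete_lattice M).

(** Least upper bounds are unique by antisymmetry, and nonemptiness of [X] keeps [supremum] from
    returning the default [x0]. *)
Lemma supremum_unique (x0 m : M) (X : set M) :
  X !=set0 -> supremums X m -> supremum x0 X = m.
Proof.
move=> /set0P/negPf X0 Xm.
by rewrite /supremum X0; apply: xget_subset1 => //; exact: is_subset1_supremums.
Qed.

Lemma le_pmeet (x y z : M) : (z <= pmeet x y) = (z <= x) && (z <= y).
Proof.
have xy0 : [set x; y] !=set0 by exists x; left.
have [lb gl] : infimums [set x; y] (pmeet x y).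
  rewrite /pmeet /infimum ifN; last exact/set0P.
  by apply: xgetPex; exact: (Mc _).2.
apply/idP/andP => [zxy|[zx zy]].
  by split; apply: le_trans zxy _; apply: lb; [left|right].
by apply: gl => t [->|->].
Qed.

Lemma pmeet_lel (x y : M) : pmeet x y <= x.
Proof. by have := lexx (pmeet x y); rewrite le_pmeet => /andP[]. Qed.

(** With [le_pmeet], this reduces the laws of [pmeet] to those of [&&]. *)
Lemma eq_from_le (x y : M) : (forall z, (z <= x) = (z <= y)) -> x = y.
Proof. by move=> xy; apply/le_anti; rewrite -xy lexx xy lexx. Qed.

Lemma pmeetC (x y : M) : pmeet x y = pmeet y x.
Proof. by apply: eq_from_le => z; rewrite !le_pmeet andbC. Qed.

Lemma pmeetA (x y z : M) : pmeet (pmeet x y) z = pmeet x (pmeet y z).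
Proof. by apply: eq_from_le => t; rewrite !le_pmeet andbA. Qed.

Lemma le_pmeet2l (x y z : M) : y <= z -> pmeet x y <= pmeet x z.
Proof.
by move=> yz; rewrite le_pmeet pmeet_lel (le_trans _ yz)// pmeetC pmeet_lel.
Qed.

End CompletePoset.

Section FMapping.
Set Implicit Arguments.
Unset Strict Implicit.
Context {d : Order.disp_t} {L : tbLatticeType d}.
Hypothesis L_complete : complete_lattice L.

Lemma bigjoin_supremums (X : set L) : supremums X (bigjoin X).
Proof.
rewrite /bigjoin /supremum; case: ifPn => [/eqP ->|_].
  by split=> // y _; exact: le0x.
by apply: xgetPex; exact: (L_complete _).1.
Qed.

Lemma le_bigjoin (X : set L) (x : L) : X x -> x <= bigjoin X.
Proof. exact: (bigjoin_supremums X).1. Qed.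

Lemma bigjoin_le (X : set L) (y : L) :
  (forall x, X x -> x <= y) -> bigjoin X <= y.
Proof. exact: (bigjoin_supremums X).2. Qed.

Context {f : L -> L} (f_map : f_mapping f).

Let Im_complete : complete_lattice (Im f) := (f_mapping_Im f_map).1.

Lemma f_mapping_homo (x y : L) : x <= y -> f x <= f y.
Proof.
(* Since [y] is the join of the pair, preservation of joins yields monotonicity. *)
move=> xy; have <- : bigjoin [set x; y] = y.
  apply/le_anti/andP; split; last by apply: le_bigjoin; right.
  by apply: bigjoin_le => _ [->|->].
rewrite (f_mapping_join f_map); last by exists x; left.
by apply: le_bigjoin; exists x => //; left.
Qed.

Lemma f_Im (u : Im f) : f (\val u) = \val u.
Proof. by case: u => _ /= /set_mem[x _ <-]; rewrite (f_mapping_idem f_map). Qed.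

Lemma to_Im_val (u : Im f) : to_Im f (\val u) = u.
Proof. by apply: val_inj; exact: f_Im. Qed.

(** Since [f] preserves nonempty joins and fixes each element of its image, it also fixes their join
    in [L], which therefore lies in the image. *)
Lemma val_supremum (u : Im f) (V : set (Im f)) : V !=set0 ->
  \val (supremum u V) = bigjoin [set \val v | v in V].
Proof.
move=> V0; have V'0 : [set \val v | v in V] !=set0.
  by case: V0 => v Vv; exists (\val v), v.
have fj : f (bigjoin [set \val v | v in V]) = bigjoin [set \val v | v in V].
  rewrite (f_mapping_join f_map)// image_comp; congr bigjoin.
  by apply: eq_imagel => v _ /=; exact: f_Im.
(* The value of this witness is [f] of the join, which [fj] identifies with the join itself. *)
rewrite (@supremum_unique _ _ _ (to_Im f (bigjoin [set \val v | v in V])))//.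
split=> [v Vv|w Vw]; rewrite -Order.le_val /= fj.
  by apply: le_bigjoin; exists v.
by apply: bigjoin_le => _ [v Vv <-]; rewrite Order.le_val; exact: Vw.
Qed.

Lemma to_Im_bigjoin (u : Im f) (S : set L) : S !=set0 ->
  to_Im f (bigjoin S) = supremum u [set to_Im f s | s in S].
Proof.
move=> S0; apply: val_inj; rewrite val_supremum ?image_comp.
  exact: (f_mapping_join f_map).
by case: S0 => s Ss; exists (to_Im f s), s.
Qed.

Lemma T_of1x (x : L) : T_of f \top x = x.
Proof. by rewrite /T_of eqxx meet1x. Qed.

Lemma T_ofx1 (x : L) : T_of f x \top = x.
Proof. by rewrite /T_of eqxx orbT meetx1. Qed.

Lemma T_ofE (x y : L) : x != \top -> y != \top ->
  T_of f x y = \val (pmeet (to_Im f x) (to_Im f y)).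
Proof. by move=> /negPf x1 /negPf y1; rewrite /T_of x1 y1. Qed.

Lemma T_ofC (x y : L) : T_of f x y = T_of f y x.
Proof. by rewrite /T_of orbC meetC (pmeetC Im_complete). Qed.

Lemma T_of_lel (x y : L) : T_of f x y <= x.
Proof.
rewrite /T_of; case: ifP => _; first exact: leIl.
by apply: le_trans (f_mapping_le f_map x); exact: (pmeet_lel Im_complete).
Qed.

(** This keeps nested products in the second case of [T_of], as needed for associativity. *)
Lemma T_of_neq_top (x y : L) : x != \top -> T_of f x y != \top.
Proof.
by apply: contra => /eqP xy1; rewrite -le1x -xy1 T_of_lel.
Qed.

Lemma T_of_mono (x y z : L) : y <= z -> T_of f x y <= T_of f x z.
Proof.
have [->|x1] := eqVneq x \top; first by rewrite !T_of1x.
(* Once [z] is not [\top], neither is [y], so both sides fall in the second case. *)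
have [->|z1] := eqVneq z \top; first by rewrite T_ofx1 T_of_lel.
move=> yz; have y1 : y != \top.
  by apply: contra z1 => /eqP y1; rewrite -le1x -y1.
rewrite !T_ofE// Order.le_val; apply: le_pmeet2l => //.
by rewrite -Order.le_val; exact: f_mapping_homo.
Qed.

Lemma T_ofA (x y z : L) : T_of f (T_of f x y) z = T_of f x (T_of f y z).
Proof.
have [->|x1] := eqVneq x \top; first by rewrite !T_of1x.
have [->|y1] := eqVneq y \top; first by rewrite T_of1x T_ofx1.
have [->|z1] := eqVneq z \top; first by rewrite !T_ofx1.
rewrite T_ofE ?T_of_neq_top// [RHS]T_ofE ?T_of_neq_top//.
(* The inner products already lie in the image, so [to_Im_val] removes the second application of
   [f]. *)
by rewrite !T_ofE// !to_Im_val (pmeetA Im_complete).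
Qed.

Lemma T_of_left_continuous :
  completely_join_irreducible (\top : L) -> left_continuous (T_of f).
Proof.
move=> top_irr a S S0.
have [->|a1] := eqVneq a \top.
  by rewrite T_of1x (eq_imagel (fun s _ => T_of1x s)) image_id.
have [S1|S1] := pselect (S \top).
  have -> : bigjoin S = \top by apply/eqP; rewrite -le1x le_bigjoin.
  rewrite T_ofx1; apply/le_anti/andP; split.
    by apply: le_bigjoin; exists \top => //; exact: T_ofx1.
  by apply: bigjoin_le => _ [s _ <-]; exact: T_of_lel.
have jS1 : bigjoin S != \top by apply/eqP => /esym/top_irr.
have s1 s : S s -> s != \top by move=> Ss; apply: contra_notN S1 => /eqP <-.
(* The default [to_Im f a] is the one occurring in [join_infinite_distributive], so that
   distributivity applies by rewriting. *)
rewrite T_ofE// (to_Im_bigjoin (to_Im f a))//.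
have [s0 Ss0] := S0.
rewrite (f_mapping_Im f_map).2; last by exists (to_Im f s0), s0.
rewrite image_comp val_supremum ?image_comp.
  by congr bigjoin; apply: eq_imagel => s Ss /=; rewrite T_ofE// s1.
by exists (pmeet (to_Im f a) (to_Im f s0)), s0.
Qed.

End FMapping.

Theorem theorem3p2 (d : Order.disp_t) (L : tbLatticeType d)
    (L_complete : complete_lattice L)
    (top_irr : completely_join_irreducible (\top : L))
    (f : L -> L) (f_map : f_mapping f) :
  t_norm (T_of f) /\ left_continuous (T_of f).
Proof.
split; last exact: T_of_left_continuous.
split; [exact: T_of1x|exact: T_of_mono|exact: T_ofC|exact: T_ofA].
Qed.
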